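(* There is an algorithm which, given positive integers $w_1,\ldots,w_n$ (item weights), an integer $M\in\{1,\ldots,n\}$, a capacity $C$, and a number $\varepsilon\in(0,1)$, outputs a number $Z'$ satisfying \[(1-\varepsilon)Z\le Z'\le(1+\varepsilon)Z,\] where $Z=\bigl|\{S\subseteq\{1,\ldots,n\}: \textstyle\sum_{i\in S}w_i\le C \text{ and } |S|=M\}\bigr|$, and which runs in time $\mathcal{O}\!\left(\frac{n^4}{\varepsilon}\log\frac{n}{\varepsilon}\right)$ (counting arithmetic operations and comparisons on the numbers involved as unit-cost).
   Context: The quantity $Z$ is the answer to the counting problem #Exact $M$-Items Knapsack: the number of subsets of the $n$ items containing exactly $M$ items whose total weight is at most the capacity $C$. *)

(* Defs.v *)
From mathcomp Require Import all_boot all_order all_algebra.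
From mathcomp Require Import reals exp.

Set Implicit Arguments.
Unset Strict Implicit.
Unset Printing Implicit Defensive.

Import Order.TTheory GRing.Theory Num.Theory.
Local Open Scope ring_scope.

(* The model of computation is a unit-cost real RAM, presented as a structured
   programming language.  Memory has two sorts of cells: index cells, which
   hold natural numbers and may be used as addresses, and number cells.  Each
   sort is organised as an N-indexed family of unbounded arrays; the array
   name is fixed in the program text, the position inside the array is
   computed.  Indices can be converted to numbers, but there is no conversion
   (floor, rounding) in the other direction, and the only index division is
   halving; this excludes the usual ways of abusing unit-cost arithmetic.
   Programs do not depend on the field of numbers and their only literals are
   natural numbers. *)

Inductive iexp :=
| IConst of nat
| ILoad of nat & iexp   (* ILoad a e : position e of index array a *)
| IAdd of iexp & iexp
| ISub of iexp & iexp   (* truncated *)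
| IMul of iexp & iexp
| IHalf of iexp.        (* rounded down *)

Inductive rexp :=
| ROfIndex of iexp
| RLoad of nat & iexp
| RAdd of rexp & rexp
| RSub of rexp & rexp
| RMul of rexp & rexp
| RDiv of rexp & rexp.

Inductive bexp :=
| BLeI of iexp & iexp
| BLeR of rexp & rexp
| BNot of bexp
| BAnd of bexp & bexp.  (* both sides are always evaluated *)

Inductive cmd :=
| Skip
| ISet of nat & iexp & iexp  (* ISet a e v : a[e] := v *)
| RSet of nat & iexp & rexp
| Seq of cmd & cmd
| If of bexp & cmd & cmd
| While of bexp & cmd.

Record store (R : realFieldType) := Store {
  imem : nat -> nat -> nat;
  rmem : nat -> nat -> R }.

Fixpoint ieval (R : realFieldType) (s : store R) (e : iexp) : nat :=
  match e with
  | IConst k => k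
  | ILoad a e1 => imem s a (ieval s e1)
  | IAdd e1 e2 => (ieval s e1 + ieval s e2)%N
  | ISub e1 e2 => (ieval s e1 - ieval s e2)%N
  | IMul e1 e2 => (ieval s e1 * ieval s e2)%N
  | IHalf e1 => (ieval s e1)./2
  end.

Fixpoint reval (R : realFieldType) (s : store R) (e : rexp) : R :=
  match e with
  | ROfIndex e1 => (ieval s e1)%:R
  | RLoad a e1 => rmem s a (ieval s e1)
  | RAdd e1 e2 => reval s e1 + reval s e2
  | RSub e1 e2 => reval s e1 - reval s e2
  | RMul e1 e2 => reval s e1 * reval s e2
  | RDiv e1 e2 => reval s e1 / reval s e2
  end.

Fixpoint beval (R : realFieldType) (s : store R) (b : bexp) : bool :=
  match b with
  | BLeI e1 e2 => (ieval s e1 <= ieval s e2)%N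
  | BLeR e1 e2 => reval s e1 <= reval s e2
  | BNot b1 => ~~ beval s b1
  | BAnd b1 b2 => beval s b1 && beval s b2
  end.

(* Evaluating an expression costs one unit per node: literals, memory
   accesses, conversions, arithmetic operations, comparisons and connectives. *)

Fixpoint icost (e : iexp) : nat :=
  match e with
  | IConst _ => 1
  | ILoad _ e1 | IHalf e1 => (icost e1).+1
  | IAdd e1 e2 | ISub e1 e2 | IMul e1 e2 => (icost e1 + icost e2).+1
  end.

Fixpoint rcost (e : rexp) : nat :=
  match e with
  | ROfIndex e1 | RLoad _ e1 => (icost e1).+1
  | RAdd e1 e2 | RSub e1 e2 | RMul e1 e2 | RDiv e1 e2 =>
      (rcost e1 + rcost e2).+1
  end.

Fixpoint bcost (b : bexp) : nat :=
  match b with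
  | BLeI e1 e2 => (icost e1 + icost e2).+1
  | BLeR e1 e2 => (rcost e1 + rcost e2).+1
  | BNot b1 => (bcost b1).+1
  | BAnd b1 b2 => (bcost b1 + bcost b2).+1
  end.

Definition upd (T : Type) (f : nat -> nat -> T) (a i : nat) (v : T) :=
  fun b j => if (b == a) && (j == i) then v else f b j.

(* [exec c s t s']: started in store [s], the command [c] terminates in store
   [s'] after exactly [t] units of time.  The relation is deterministic
   (lemma [exec_det]). *)
Inductive exec (R : realFieldType) :
  cmd -> store R -> nat -> store R -> Prop :=
| ExecSkip s : exec Skip s 1 s
| ExecISet a e v s :
    exec (ISet a e v) s (icost e + icost v).+1
      (Store (upd (imem s) a (ieval s e) (ieval s v)) (rmem s))
| ExecRSet a e v s :
    exec (RSet a e v) s (icost e + rcost v).+1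
      (Store (imem s) (upd (rmem s) a (ieval s e) (reval s v)))
| ExecSeq c1 c2 s1 s2 s3 t1 t2 :
    exec c1 s1 t1 s2 -> exec c2 s2 t2 s3 ->
    exec (Seq c1 c2) s1 (t1 + t2) s3
| ExecIfT b c1 c2 s s' t :
    beval s b -> exec c1 s t s' ->
    exec (If b c1 c2) s (bcost b + t).+1 s'
| ExecIfF b c1 c2 s s' t :
    ~~ beval s b -> exec c2 s t s' ->
    exec (If b c1 c2) s (bcost b + t).+1 s'
| ExecWhileT b c s1 s2 s3 t1 t2 :
    beval s1 b -> exec c s1 t1 s2 -> exec (While b c) s2 t2 s3 ->
    exec (While b c) s1 (bcost b + t1 + t2).+1 s3
| ExecWhileF b c s :
    ~~ beval s b -> exec (While b c) s (bcost b).+1 s.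

Lemma exec_det (R : realFieldType) c (s : store R) t1 s1 t2 s2 :
  exec c s t1 s1 -> exec c s t2 s2 -> t1 = t2 /\ s1 = s2.
Proof.
move=> H; elim: H t2 s2 => {c s t1 s1} *;
  match goal with H : exec _ _ _ _ |- _ => inversion H; subst end;
  repeat match goal with
  | IH : forall t s, exec ?c ?s0 t s -> _, H : exec ?c ?s0 _ _ |- _ =>
      case: (IH _ _ H) => ? ?; subst; clear H
  | H1 : is_true (beval ?s ?b), H2 : is_true (~~ beval ?s ?b) |- _ =>
      by rewrite H1 in H2
  end; by [].
Qed.

(* Index array 0 holds n, M; number array 0 holds w_1, ..., w_n (from
   position 0 on); number array 1 holds C, eps; all other cells are 0. *)
Definition knapsack_input (R : realFieldType) (n : nat) (w : 'I_n -> nat)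
    (M : nat) (C eps : R) : store R :=
  {| imem := fun a i => if a == 0%N then nth 0%N [:: n; M] i else 0%N;
     rmem := fun a i =>
       if a == 0%N then oapp (fun j : 'I_n => (w j)%:R) 0 (insub i)
       else if a == 1%N then nth 0 [:: C; eps] i
       else 0 |}.

Definition output (R : realFieldType) (s : store R) : R := rmem s 2 0.

Definition exact_knapsack_count (R : realFieldType) (n : nat)
    (w : 'I_n -> nat) (M : nat) (C : R) : nat :=
  #|[set S : {set 'I_n} | ((\sum_(i in S) w i)%N%:R <= C) && (#|S| == M)]|.

(* n^4/eps * log(n/eps).  Since log(n/eps) tends to 0 when n = 1 and eps tends
   to 1, whereas every run takes at least one step, the argument of the
   logarithm is cut off from below at 2; this affects only n = 1 and
   eps > 1/2. *)
Definition time_bound (R : realType) (n : nat) (eps : R) : R :=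
  n%:R ^+ 4 / eps * ln (Num.max 2 (n%:R / eps)).

(* Main.v *)
(* For every i and m, the function sending c to the number of m-subsets of the
   first i items of weight at most c is the distribution function of a discrete
   measure on the line, and it satisfies
     F (i+1) (m+1) c = F i (m+1) c + F i m (c - w_i).
   A measure is stored as a list of atoms (position, mass) sorted by position.
   Adding two measures is merging their lists; the merged list is then thinned
   out in one pass: an atom is dropped, and its mass added to the next kept
   atom, as long as the kept mass stays at least r = 1 - eps/n times the mass
   read so far.  This costs one factor r per item, and
   r^n >= 1 - eps by Bernoulli.  All masses are at least 1, the total mass is at
   most 2^i, and the kept mass grows by a factor 1/r from one kept atom to the
   next, so a list has O(n^2/eps) atoms.  There are O(n^2) merges, each linear
   in the lengths, whence O(n^4/eps) steps; the logarithm in the bound is not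
   even used, beyond being bounded away from 0. *)

Require Import Defs.
From mathcomp Require Import all_boot all_order all_algebra.
From mathcomp Require Import reals exp.
From mathcomp Require Import ring lra zify.

Set Implicit Arguments.
Unset Strict Implicit.
Unset Printing Implicit Defensive.

Import Order.TTheory GRing.Theory Num.Theory.
Local Open Scope ring_scope.

(** * Measures with finitely many atoms *)

Section Atoms.
Variable R : realFieldType.
Implicit Types (l : seq (R * R)) (c r acc kept w : R).

Definition cdf l c := \sum_(a <- l | a.1 <= c) a.2.
Definition mass l := \sum_(a <- l) a.2.
Definition shift w l := [seq (a.1 + w, a.2) | a <- l].
Definition le1 (a b : R * R) := a.1 <= b.1.

(* [acc] is the mass read so far, [kept] the mass already output. *)
Fixpoint compress r acc kept l :=
  if l is a :: l' then
    if r * (acc + a.2) <= kept then compress r (acc + a.2) kept l'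
    else (a.1, acc + a.2 - kept) :: compress r (acc + a.2) (acc + a.2) l'
  else [::].

Definition combine r w l1 l2 := compress r 0 0 (merge le1 l1 (shift w l2)).

(** Sortedness lets a scan stop at an abscissa; masses of at least 1 give the geometric growth of
    the kept mass its starting value. *)
Definition good l := sorted le1 l && all (fun a => 1 <= a.2) l.

Lemma le1_trans : transitive le1.
Proof. by move=> b a c; apply: le_trans. Qed.

Lemma le1_total : total le1.
Proof. by move=> a b; apply: le_total. Qed.

Lemma cdf_cons a l c : cdf (a :: l) c = (if a.1 <= c then a.2 else 0) + cdf l c.
Proof. by rewrite /cdf big_cons; case: ifP => // _; rewrite add0r. Qed.

Lemma cdf_out l c : all (fun a => c < a.1) l -> cdf l c = 0.
Proof.
elim: l => [|a l IHl] /=; first by rewrite /cdf big_nil.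
by case/andP=> ca cl; rewrite cdf_cons leNgt ca IHl // addr0.
Qed.

Lemma cdf_shift w l c : cdf (shift w l) c = cdf l (c - w).
Proof. by rewrite /cdf big_map; apply: eq_bigl => a; rewrite lerBrDr. Qed.

Lemma cdf_merge l1 l2 c : cdf (merge le1 l1 l2) c = cdf l1 c + cdf l2 c.
Proof. by rewrite /cdf -big_cat; apply: perm_big; rewrite perm_merge. Qed.

Lemma mass_merge l1 l2 : mass (merge le1 l1 l2) = mass l1 + mass l2.
Proof. by rewrite /mass -big_cat; apply: perm_big; rewrite perm_merge. Qed.

Lemma mass_shift w l : mass (shift w l) = mass l.
Proof. by rewrite /mass big_map. Qed.

Lemma all_compress (P : pred R) r acc kept l :
  all (fun a => P a.1) l -> all (fun a => P a.1) (compress r acc kept l).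
Proof.
elim: l acc kept => //= a l IHl acc kept /andP[Pa Pl].
by case: ifP => _; rewrite /= ?Pa IHl.
Qed.

Lemma sorted_compress r acc kept l :
  sorted le1 l -> sorted le1 (compress r acc kept l).
Proof.
elim: l acc kept => //= a l IHl acc kept.
rewrite !(path_sortedE le1_trans) => /andP[al sl].
case: ifP => _; first exact: IHl.
rewrite /= (path_sortedE le1_trans) IHl // andbT.
exact: (@all_compress (fun x => a.1 <= x)).
Qed.

Lemma all_compress_ge1 r acc kept l : kept <= acc ->
  all (fun a => 1 <= a.2) l -> all (fun a => 1 <= a.2) (compress r acc kept l).
Proof.
elim: l acc kept => //= a l IHl acc kept ka /andP[a1 l1].
case: ifP => _ /=; first by apply: IHl => //; lra.
by rewrite IHl // andbT; lra.
Qed.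

Lemma good_merge_shift w l1 l2 :
  good l1 -> good l2 -> good (merge le1 l1 (shift w l2)).
Proof.
case/andP=> s1 a1 /andP[s2 a2]; apply/andP; split.
  apply: merge_sorted => //; first exact: le1_total.
  rewrite /shift sorted_map; apply: sub_sorted s2 => a b.
  by rewrite /le1 /relpre /= lerD2r.
apply/allP => a; rewrite mem_merge mem_cat => /orP[/(allP a1)//|].
by case/mapP=> b /(allP a2) /= b1 ->.
Qed.

Lemma good_combine r w l1 l2 : good l1 -> good l2 -> good (combine r w l1 l2).
Proof.
move=> g1 g2; have /andP[sm am] := good_merge_shift w g1 g2.
by rewrite /good sorted_compress //= all_compress_ge1.
Qed.

(** Generalised over the running totals for the induction. Once the scan passes [c], sortedness puts
    all later atoms beyond [c], and the claim becomes the invariant on [acc] and [kept]. *)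
Lemma compress_cdf r acc kept l c : 0 <= r <= 1 ->
  0 <= acc -> r * acc <= kept <= acc -> good l ->
  r * (acc + cdf l c) <= kept + cdf (compress r acc kept l) c <= acc + cdf l c.
Proof.
move=> r01; rewrite /good.
elim: l acc kept => [|a l IHl] acc kept acc0 ak /=.
  by rewrite /cdf !big_nil !addr0.
rewrite (path_sortedE le1_trans) => /and3P[/andP[al sl] a1 l1].
have [ac|ca] := leP a.1 c; last first.
  have cl : all (fun b => c < b.1) (a :: l).
    by rewrite /= ca; apply: sub_all al => b; apply: lt_le_trans.
  have := @all_compress (fun x => c < x) r acc kept _ cl.
  by move=> /cdf_out /= ->; rewrite cdf_out // !addr0.
rewrite cdf_cons ac addrA.
have gl : sorted le1 l && all (fun a => 1 <= a.2) l by rewrite sl.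
have acc'0 : 0 <= acc + a.2 by lra.
case: (leP (r * (acc + a.2))) => le_k; first by apply: IHl => //; lra.
(* Keeping an atom brings [kept] level with [acc], so the invariant is restored because [r <= 1]. *)
rewrite cdf_cons /= ac addrA subrKC.
by apply: IHl => //; rewrite lexx andbT ler_piMl //; lra.
Qed.

Lemma combine_cdf r w l1 l2 c : 0 <= r <= 1 -> good l1 -> good l2 ->
  r * (cdf l1 c + cdf l2 (c - w)) <= cdf (combine r w l1 l2) c
    <= cdf l1 c + cdf l2 (c - w).
Proof.
move=> r01 g1 g2;
have := @compress_cdf r 0 0 _ c r01 (lexx 0) _ (good_merge_shift w g1 g2).
by rewrite cdf_merge cdf_shift !add0r; apply; rewrite mulr0 lexx.
Qed.

Lemma mass_compress r acc kept l : kept <= acc -> all (fun a => 1 <= a.2) l ->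
  kept + mass (compress r acc kept l) <= acc + mass l.
Proof.
elim: l acc kept => [|a l IHl] acc kept ka /=; first by rewrite /mass !big_nil; lra.
case/andP=> a1 l1; rewrite {2}/mass big_cons -/(mass _) addrA.
case: ifP => _; first by apply: IHl => //; lra.
by rewrite /mass big_cons /= -!/(mass _) addrA subrKC; apply: IHl.
Qed.

Lemma mass_combine r w l1 l2 : good l1 -> good l2 ->
  mass (combine r w l1 l2) <= mass l1 + mass l2.
Proof.
move=> g1 g2; have /andP[_ am] := good_merge_shift w g1 g2.
by have := mass_compress r (lexx 0) am; rewrite mass_merge mass_shift !add0r.
Qed.

(** An atom is kept only when [kept] is below [r] times the new total, so each output atom
    contributes one factor [r]. *)
Lemma compress_mass_ge r acc kept l : 0 <= r ->
  kept <= (kept + mass (compress r acc kept l)) * r ^+ size (compress r acc kept l).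
Proof.
move=> r0; elim: l acc kept => [|a l IHl] acc kept /=.
  by rewrite /mass big_nil addr0 mulr1.
case: ifP => [_|/negbT]; first exact: IHl.
rewrite -ltNge => /ltW le_k; rewrite /mass big_cons /= -/(mass _) addrA subrKC.
apply: le_trans le_k _; rewrite exprS mulrCA; exact: ler_wpM2l.
Qed.

(** The first output atom raises the kept mass to at least 1; only the remaining atoms contribute
    factors [r], whence the predecessor. *)
Lemma compress_size r acc kept l : 0 <= r -> 0 <= kept <= acc ->
  all (fun a => 1 <= a.2) l -> (0 < size (compress r acc kept l))%N ->
  1 <= (kept + mass (compress r acc kept l)) * r ^+ (size (compress r acc kept l)).-1.
Proof.
move=> r0; elim: l acc kept => [|a l IHl] //= acc kept ka /andP[a1 l1].
case: ifP => [_|_ _]; first by apply: IHl => //; lra.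
rewrite /mass big_cons /= -/(mass _) addrA subrKC.
by apply: le_trans (compress_mass_ge _ _ _ r0); lra.
Qed.

End Atoms.

(** * Cost-bounded executions *)

Section Runs.
Variable R : realFieldType.
Implicit Types (s : store R) (Q : store R -> Prop).

(** Total correctness within a time budget; an upper bound instead of the exact time lets branches
    of different cost be joined. *)
Definition runs c s (N : nat) Q :=
  exists t s', [/\ exec c s t s', (t <= N)%N & Q s'].

Lemma runs_weaken c s N N' Q Q' : runs c s N Q -> (N <= N')%N ->
  (forall s', Q s' -> Q' s') -> runs c s N' Q'.
Proof.
case=> t [s' [ex tN Qs]] NN QQ; exists t, s'.
by split=> //; [apply: leq_trans NN | apply: QQ].
Qed.

Lemma runs_le c s N N' Q : runs c s N Q -> (N <= N')%N -> runs c s N' Q.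
Proof. by move=> H NN; apply: runs_weaken H NN _. Qed.

Lemma runs_skip s Q : Q s -> runs Skip s 1 Q.
Proof. by move=> Qs; exists 1%N, s; split=> //; constructor. Qed.

Lemma runs_iset a e v s Q :
  Q (Store (upd (imem s) a (ieval s e) (ieval s v)) (rmem s)) ->
  runs (ISet a e v) s (icost e + icost v).+1 Q.
Proof. by move=> Qs; do 2!eexists; split; [constructor | |exact: Qs]. Qed.

Lemma runs_rset a e v s Q :
  Q (Store (imem s) (upd (rmem s) a (ieval s e) (reval s v))) ->
  runs (RSet a e v) s (icost e + rcost v).+1 Q.
Proof. by move=> Qs; do 2!eexists; split; [constructor | |exact: Qs]. Qed.

Lemma runs_seq c1 c2 s N1 N2 Q :
  runs c1 s N1 (fun s1 => runs c2 s1 N2 Q) -> runs (Seq c1 c2) s (N1 + N2) Q.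
Proof.
case=> t1 [s1 [ex1 tN1 [t2 [s2 [ex2 tN2 Qs]]]]].
by exists (t1 + t2)%N, s2; split=> //; [apply: ExecSeq ex1 ex2 | apply: leq_add].
Qed.

Lemma runs_if b c1 c2 s N Q :
  (beval s b -> runs c1 s N Q) -> (~~ beval s b -> runs c2 s N Q) ->
  runs (If b c1 c2) s (bcost b + N).+1 Q.
Proof.
move=> H1 H2; case: (boolP (beval s b)) => bs.
  case: (H1 bs) => t [s' [ex tN Qs]]; exists (bcost b + t).+1, s'.
  by split=> //; [apply: ExecIfT | rewrite ltnS leq_add2l].
case: (H2 bs) => t [s' [ex tN Qs]]; exists (bcost b + t).+1, s'.
by split=> //; [apply: ExecIfF | rewrite ltnS leq_add2l].
Qed.

(** The index of the invariant is the number of iterations left, so it also proves termination. *)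
Lemma runs_while b c (Inv : nat -> store R -> Prop) N k s Q :
  (forall k s, Inv k.+1 s -> beval s b /\ runs c s N (Inv k)) ->
  (forall s, Inv 0%N s -> ~~ beval s b /\ Q s) ->
  Inv k s -> runs (While b c) s (k * (bcost b + N).+1 + (bcost b).+1) Q.
Proof.
move=> Hbody Hexit; elim: k s => [|k IHk] s Is.
  case: (Hexit _ Is) => bs Qs; exists (bcost b).+1, s.
  by split=> //; apply: ExecWhileF.
case: (Hbody _ _ Is) => bs [t [s' [ex tN /IHk [t' [s2 [ex' tN' Qs]]]]]].
exists (bcost b + t + t').+1, s2; split=> //; first exact: ExecWhileT ex ex'.
by rewrite mulSn; lia.
Qed.

End Runs.

Ltac straight :=
  apply: runs_le; [repeat (first
    [apply: runs_seq | apply: runs_iset | apply: runs_rset | apply: runs_skip]);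
    rewrite /= /upd /= | by []].

(** * The program *)

Definition iv a := ILoad a (IConst 0).
Definition rv a := RLoad a (IConst 0).
Definition iset a := ISet a (IConst 0).
Definition rset a := RSet a (IConst 0).

(* Cell m of the current table row is the list of atoms stored at positions
   imem 1 m, ..., imem 2 m - 1 of the arrays rmem 4 (abscissae) and rmem 5
   (masses).  Scalars: imem 3 = i, imem 4 = m, imem 5/6 and 7/8 = current
   position and end of the two lists being merged, imem 9 = first free
   position; rmem 3 = r, rmem 6 = acc, rmem 7 = kept, rmem 8 = abscissa of the
   atom just taken. *)
Definition not_done lo hi := BNot (BLeI (iv hi) (iv lo)).

Definition shifted := RAdd (RLoad 4 (iv 7)) (RLoad 0 (iv 3)).

(** Ties go to the left list, as in [merge]. Both operands of [BAnd] are evaluated, possibly past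
    the end of a list, which is harmless because memory is total. *)
Definition take_left :=
  BAnd (not_done 5 6) (BNot (BAnd (not_done 7 8) (BNot (BLeR (RLoad 4 (iv 5)) shifted)))).

Definition pop :=
  If take_left
    (Seq (rset 8 (RLoad 4 (iv 5)))
    (Seq (rset 6 (RAdd (rv 6) (RLoad 5 (iv 5))))
         (iset 5 (IAdd (iv 5) (IConst 1)))))
    (Seq (rset 8 shifted)
    (Seq (rset 6 (RAdd (rv 6) (RLoad 5 (iv 7))))
         (iset 7 (IAdd (iv 7) (IConst 1))))).

Definition push :=
  If (BLeR (RMul (rv 3) (rv 6)) (rv 7)) Skip
    (Seq (RSet 4 (iv 9) (rv 8))
    (Seq (RSet 5 (iv 9) (RSub (rv 6) (rv 7)))
    (Seq (rset 7 (rv 6))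
         (iset 9 (IAdd (iv 9) (IConst 1)))))).

Definition merge_loop :=
  While (BNot (BAnd (BLeI (iv 6) (iv 5)) (BLeI (iv 8) (iv 7)))) (Seq pop push).

(** * Correctness and cost of one merge *)

Section Merge.
Variable R : realFieldType.
Implicit Types (s : store R) (l out : seq (R * R)).

Definition holds s a l := forall k, (k < size l)%N ->
  (rmem s 4 (a + k)%N, rmem s 5 (a + k)%N) = nth (0, 0) l k.

(** What a merge leaves intact: the input, the table bookkeeping, [r], and all atoms below the free
    position [h]. *)
Definition frame s0 h s :=
  [/\ forall a i, (a < 5)%N -> imem s a i = imem s0 a i,
      forall a i, (a < 4)%N -> rmem s a i = rmem s0 a i &
      forall k, (k < h)%N ->
        rmem s 4 k = rmem s0 4 k /\ rmem s 5 k = rmem s0 5 k].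

Lemma holds_cons s a x l : holds s a (x :: l) ->
  [/\ rmem s 4 a = x.1, rmem s 5 a = x.2 & holds s a.+1 l].
Proof.
move=> H; have := H 0%N isT; rewrite addn0 /= => <-; split=> // k kl.
by rewrite addSnnS; apply: H.
Qed.

Lemma holds_frame s0 h s a l : frame s0 h s -> (a + size l <= h)%N ->
  holds s0 a l -> holds s a l.
Proof.
case=> _ _ F ah H k kl; rewrite -H //.
by have [-> ->] : rmem s 4 (a + k)%N = rmem s0 4 (a + k)%N /\
  rmem s 5 (a + k)%N = rmem s0 5 (a + k)%N by apply: F; lia.
Qed.

(** The unread lists are located in the initial store [s0]; as they end below [h], [frame] carries
    them over to [s]. *)
Record mstate s0 h l1 l2 out (acc kept : R) s : Prop := MState {
  ms_p : imem s 6 0 = (imem s 5 0 + size l1)%N;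
  ms_q : imem s 8 0 = (imem s 7 0 + size l2)%N;
  ms_ph : (imem s 6 0 <= h)%N;
  ms_qh : (imem s 8 0 <= h)%N;
  ms_l1 : holds s0 (imem s 5 0) l1;
  ms_l2 : holds s0 (imem s 7 0) l2;
  ms_top : imem s 9 0 = (h + size out)%N;
  ms_out : holds s h out;
  ms_acc : rmem s 6 0 = acc;
  ms_kept : rmem s 7 0 = kept;
  ms_frame : frame s0 h s }.

(* Here and below the numerical constants are rounded-up costs of fixed pieces
   of program text. *)
Lemma runs_pop s0 h l1 l2 out acc kept s :
  mstate s0 h l1 l2 out acc kept s -> (0 < size l1 + size l2)%N ->
  let w := rmem s0 0 (imem s0 3 0) in
  runs pop s 60 (fun s' => exists l1' l2' z,
   [/\ mstate s0 h l1' l2' out (acc + z.2) kept s', rmem s' 8 0 = z.1,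
       merge (@le1 R) l1 (shift w l2) = z :: merge (@le1 R) l1' (shift w l2') &
       (size l1 + size l2)%N = (size l1' + size l2').+1]).
Proof.
move=> [mp mq mph mqh ml1 ml2 mt mo ma mk mf] nz w.
have [fi fr fh] := mf.
have L1 := holds_frame mf _ ml1; have L2 := holds_frame mf _ ml2.
apply: (@runs_le _ _ _ (bcost take_left + 30).+1) => //.
apply: runs_if => /=; rewrite -!ltnNge => tl.
- straight; case: l1 mp ml1 L1 nz tl => [|x1 l1] mp ml1 L1 nz tl.
    by move: tl; rewrite mp addn0 ltnn.
  have [X1 D1 ml1'] := holds_cons ml1.
  have [X1' D1' _] : [/\ rmem s 4 (imem s 5 0) = x1.1,
    rmem s 5 (imem s 5 0) = x1.2 & True].
    by case: (holds_cons (L1 _)) => //; lia.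
  exists l1, l2, x1; split=> //.
  + split=> //=; rewrite ?ma ?D1' ?addn1 //; first by rewrite mp /= addnS.
    by split=> [[|[|[|[|[|]]]]]|[|[|[|[|]]]]|] //= i _; rewrite ?fi ?fr.
  + case: l2 ml2 L2 mq nz tl => [|x2 l2] ml2 L2 mq nz tl /=; first by case: (l1).
    have [X2 D2 _] : [/\ rmem s 4 (imem s 7 0) = x2.1,
      rmem s 5 (imem s 7 0) = x2.2 & True].
      by case: (holds_cons (L2 _)) => //; lia.
    case/andP: tl => _; rewrite X1' X2 (fr 0%N) // (fi 3%N) //.
    have -> : (imem s 7 0 < imem s 8 0)%N by rewrite mq /=; lia.
    by rewrite negbK /le1 /= => ->.
- straight; case: l2 mq ml2 L2 nz tl => [|x2 l2] mq ml2 L2 nz tl.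
    (* If the right list is empty, the test fails only when the left one is empty too, against
       [nz]. *)
    move: tl; rewrite mq mp /= addn0 ltnn /= andbT.
    by case: (l1) nz => //= x l _; rewrite -[X in (X < _)%N]addn0 ltn_add2l.
  have [X2 D2 ml2'] := holds_cons ml2.
  have [X2' D2' _] : [/\ rmem s 4 (imem s 7 0) = x2.1,
    rmem s 5 (imem s 7 0) = x2.2 & True].
    by case: (holds_cons (L2 _)) => //; lia.
  exists l1, l2, (x2.1 + w, x2.2); split=> //=; last by rewrite addnS.
  + split=> //=; rewrite ?ma ?D2' ?addn1 //; first by rewrite mq /= addnS.
    by split=> [[|[|[|[|[|]]]]]|[|[|[|[|]]]]|] //= i _; rewrite ?fi ?fr.
  + by rewrite X2' (fr 0%N) // (fi 3%N).
  + case: l1 ml1 L1 mp nz tl => [|x1 l1] ml1 L1 mp nz tl //=.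
    have [X1 D1 _] : [/\ rmem s 4 (imem s 5 0) = x1.1,
      rmem s 5 (imem s 5 0) = x1.2 & True].
      by case: (holds_cons (L1 _)) => //; lia.
    move: tl; rewrite X1 X2' (fr 0%N) // (fi 3%N) //.
    have -> : (imem s 5 0 < imem s 6 0)%N by rewrite mp /=; lia.
    by rewrite /= negbK => /andP[_]; rewrite /le1 /= => /negbTE->.
Qed.

Lemma runs_push s0 h l1 l2 out z1 acc kept s :
  mstate s0 h l1 l2 out acc kept s -> rmem s 8 0 = z1 ->
  let: (out', kept') := if rmem s0 3 0 * acc <= kept then (out, kept)
                        else (rcons out (z1, acc - kept), acc) in
  runs push s 40 (mstate s0 h l1 l2 out' acc kept').
Proof.
move=> ms z1E; have [mp mq mph mqh ml1 ml2 mt mo ma mk mf] := ms.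
have [fi fr fh] := mf.
case: ifPn => le_k;
  apply: (@runs_le _ _ _ (bcost (BLeR (RMul (rv 3) (rv 6)) (rv 7)) + 30).+1) => //;
  apply: runs_if => /=; rewrite ma mk (fr 3%N) // ?le_k // ?(negbTE le_k) // => _.
  by straight.
straight; split=> //=.
- by rewrite mt size_rcons addn1 addnS.
- move=> k; rewrite size_rcons ltnS nth_rcons leq_eqVlt => /orP[/eqP->|kl] /=.
    by rewrite mt z1E ma mk !eqxx ltnn.
  by rewrite mt eqn_add2l (ltn_eqF kl) kl mo.
- split=> [[|[|[|[|[|]]]]]|[|[|[|[|]]]]|] //=;
    try by move=> i _; rewrite ?fi ?fr.
  by move=> k kh; rewrite mt (ltn_eqF (ltn_addr _ kh)) /=; apply: fh.
Qed.

Lemma runs_merge s0 h l1 l2 s :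
  mstate s0 h l1 l2 [::] 0 0 s ->
  runs merge_loop s ((size l1 + size l2) * 150 + 20)
    (fun s' => let res := combine (rmem s0 3 0) (rmem s0 0 (imem s0 3 0)) l1 l2 in
      [/\ imem s' 9 0 = (h + size res)%N, holds s' h res & frame s0 h s']).
Proof.
set w := rmem s0 0 _; set r := rmem s0 3 0 => ms.
(* The atoms already output, followed by the compression still to be done from the current totals,
   always make up the final result; [k] counts unread atoms. *)
pose Inv k s := exists l1' l2' out acc kept,
  [/\ mstate s0 h l1' l2' out acc kept s, k = (size l1' + size l2')%N &
   out ++ compress r acc kept (merge (@le1 R) l1' (shift w l2')) = combine r w l1 l2].
apply: runs_le; first apply: (runs_while (Inv := Inv) (N := 100)
    (k := (size l1 + size l2)%N)) => [k t|t|].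
  - case=> l1' [l2' [out [acc [kept [ms' kE resE]]]]].
    have [mp mq _ _ _ _ _ _ _ _ _] := ms'; split; first by rewrite /=; lia.
    apply: (@runs_le _ _ _ (60 + 40)%N) => //; apply: runs_seq.
    apply: runs_weaken (runs_pop ms' _) _ _ => //; first by rewrite -kE.
    move=> s1 [l1a [l2a [z [ms1 z1E mE sE]]]].
    have := runs_push ms1 z1E.
    case: ifP => le_k H; apply: runs_weaken H _ _ => // s2 ms2.
      exists l1a, l2a, out, (acc + z.2), kept; split=> //; first by lia.
      by rewrite -resE mE /= le_k.
    exists l1a, l2a, (rcons out (z.1, acc + z.2 - kept)), (acc + z.2), (acc + z.2).
    split=> //; first by lia.
    by rewrite -resE mE /= le_k cat_rcons.
  - case=> l1' [l2' [out [acc [kept [ms' kE resE]]]]].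
    have [mp mq _ _ _ _ mt mo _ _ mf] := ms'; split; first by rewrite /=; lia.
    have /nilP l10 : nilp l1' by rewrite /nilp; lia.
    have /nilP l20 : nilp l2' by rewrite /nilp; lia.
    by move: resE; rewrite l10 l20 /= cats0 => <-.
  - by exists l1, l2, [::], 0, 0.
by rewrite /=; lia.
Qed.

End Merge.

(** * The table: filling it and reading off the answer *)

Definition mplus1 := IAdd (ILoad 0 (IConst 1)) (IConst 1).

Definition load_cell :=
  Seq (iset 5 (ILoad 1 (iv 4)))
  (Seq (iset 6 (ILoad 2 (iv 4)))
  (Seq (iset 7 (ILoad 1 (ISub (iv 4) (IConst 1))))
  (Seq (iset 8 (ILoad 2 (ISub (iv 4) (IConst 1))))
  (Seq (rset 6 (ROfIndex (IConst 0)))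
  (Seq (rset 7 (ROfIndex (IConst 0)))
       (ISet 1 (iv 4) (iv 9))))))).

Definition close_cell :=
  Seq (ISet 2 (iv 4) (iv 9)) (iset 4 (ISub (iv 4) (IConst 1))).

Definition fill_cell := Seq load_cell (Seq merge_loop close_cell).

(** Rows are overwritten in place: a cell needs the old cell to its left, so the columns run
    downwards. *)
Definition fill_row := While (BLeI (IConst 1) (iv 4)) fill_cell.

Definition fill_table :=
  While (BNot (BLeI (ILoad 0 (IConst 0)) (iv 3)))
    (Seq (iset 4 mplus1) (Seq fill_row (iset 3 (IAdd (iv 3) (IConst 1))))).

(** Row 0 has the single atom of abscissa 0 and mass 1, in column 1; its abscissa and its start are
    already 0 in memory. *)
Definition init_table :=
  Seq (rset 3 (RSub (ROfIndex (IConst 1))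
                    (RDiv (RLoad 1 (IConst 1)) (ROfIndex (ILoad 0 (IConst 0))))))
  (Seq (rset 5 (ROfIndex (IConst 1)))
  (Seq (ISet 2 (IConst 1) (IConst 1))
       (iset 9 (IConst 1)))).

Definition read_off :=
  While (not_done 5 6)
    (Seq (If (BLeR (RLoad 4 (iv 5)) (RLoad 1 (IConst 0)))
             (rset 2 (RAdd (rv 2) (RLoad 5 (iv 5)))) Skip)
         (iset 5 (IAdd (iv 5) (IConst 1)))).

Definition knapsack_prog :=
  Seq init_table (Seq fill_table
    (Seq (iset 5 (ILoad 1 mplus1)) (Seq (iset 6 (ILoad 2 mplus1)) read_off))).

(** * Correctness and cost of the whole program *)

Section Tables.
Variable R : realFieldType.
Implicit Types (s : store R) (T : nat -> seq (R * R)) (r : R) (W : nat -> R).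

(* Columns are shifted by one: column m.+1 counts the sets of m items and
   column 0 stays empty. *)
Fixpoint tab r W i : nat -> seq (R * R) :=
  if i is i'.+1 then fun j =>
    if j is j'.+1 then combine r (W i') (tab r W i' j) (tab r W i' j') else [::]
  else fun j => if j == 1%N then [:: (0, 1)] else [::].

Lemma tab0 r W i : tab r W i 0 = [::].
Proof. by case: i. Qed.

Definition table B s T := forall j, (j <= B)%N ->
  [/\ imem s 2 j = (imem s 1 j + size (T j))%N, (imem s 2 j <= imem s 9 0)%N
    & holds s (imem s 1 j) (T j)].

Definition same_input s0 s :=
  (forall i, imem s 0 i = imem s0 0 i) /\
  (forall a i, (a < 4)%N -> rmem s a i = rmem s0 a i).

Lemma eq_table B s T T' :
  (forall j, (j <= B)%N -> T j = T' j) -> table B s T -> table B s T'.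
Proof. by move=> TT H j jB; have := H j jB; rewrite TT. Qed.

(** The new list is written from the free position on, above all stored lists, so the other cells
    survive. *)
Lemma runs_fill_cell B s T m L : table B s T -> imem s 4 0 = m.+1 -> (m < B)%N ->
  (size (T m.+1) <= L)%N -> (size (T m) <= L)%N ->
  runs fill_cell s (300 * L + 100) (fun s' =>
    [/\ imem s' 4 0 = m, imem s' 3 0 = imem s 3 0, same_input s s' &
        table B s' (fun j => if j == m.+1
          then combine (rmem s 3 0) (rmem s 0 (imem s 3 0)) (T m.+1) (T m)
          else T j)]).
Proof.
move=> tT i4 mB L1 L2.
have [e1 h1 H1] := tT _ mB; have [e2 h2 H2] := tT _ (ltnW mB).
apply: (@runs_le _ _ _ (50 + (((size (T m.+1) + size (T m)) * 150 + 20) + 20))); last by lia.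
apply: runs_seq; straight; rewrite i4 subn1 /=.
set s1 := Store _ _.
have ms1 : mstate s1 (imem s 9 0) (T m.+1) (T m) [::] 0 0 s1.
  by split; rewrite // addn0.
apply: runs_weaken (runs_merge ms1) _ _ => // s2 /=.
set res := combine _ _ _ _ => -[t2 ho2 [fi fr fh]].
have {}fi a i : (a < 5)%N -> imem s2 a i = imem s1 a i := fi a i.
have i42 : imem s2 4 0 = m.+1 by rewrite fi.
straight; rewrite i42 subn1; split=> //=.
- by rewrite fi.
- split=> [i|[|[|[|[|]]]] i a4] /=; by [rewrite fi | rewrite fr |].
- move=> j jB /=; have [ej hj Hj] := tT j jB; rewrite t2.
  rewrite (fi 1%N) // [imem s1 1 j]/=.
  have [_|jm] := eqVneq j m.+1; first by split.
  rewrite fi //=; split=> //; first by apply: leq_trans hj _; apply: leq_addr.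
  by apply: (@holds_frame _ s1 (imem s 9 0) s2 _ _ _ _ Hj) => //; rewrite -ej.
Qed.

Lemma runs_fill_row r W B s i L : table B s (tab r W i) ->
  imem s 4 0 = B -> imem s 3 0 = i -> rmem s 3 0 = r -> rmem s 0 i = W i ->
  (forall j, (size (tab r W i j) <= L)%N) ->
  runs fill_row s (B * (300 * L + 110) + 10) (fun s' =>
    [/\ imem s' 3 0 = i, same_input s s' & table B s' (tab r W i.+1)]).
Proof.
move=> tT i4 i3 r3 r0 sL.
(* Columns up to [k] still hold row [i], those above already hold row [i.+1]. *)
pose Inv k s' := [/\ imem s' 4 0 = k, (k <= B)%N, imem s' 3 0 = i, same_input s s' &
  table B s' (fun j => if (j <= k)%N then tab r W i j else tab r W i.+1 j)].
apply: runs_le; first apply: (runs_while (Inv := Inv) (N := (300 * L + 100)%N) (k := B)).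
- move=> k t [t4 kB t3 [ti tr] tt]; split; first by rewrite /= t4.
  apply: runs_weaken (runs_fill_cell (L := L) tt t4 kB _ _) _ _ => //;
    rewrite ?leqnn ?leqnSn //.
  move=> t' [t'4 t'3 [t'i t'r] tt']; split=> //.
  + exact: ltnW.
  + by rewrite t'3.
  + by split=> [u|a u a4]; rewrite ?t'i ?t'r ?ti ?tr.
  + apply: eq_table tt' => j jB; rewrite t3 !tr // r3 r0.
    by rewrite -[(j <= k)%N]ltnS; case: ltngtP => // ->.
- move=> t [t4 _ t3 ts tt]; split; first by rewrite /= t4.
  (* Only column 0 is left from row [i], and it is empty in every row. *)
  by split=> //; apply: eq_table tt => -[|j] //= _; rewrite tab0.
- split=> //; apply: eq_table tT => j -> //.
- by rewrite /=; lia.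
Qed.

Lemma runs_fill_table r W n M s L : table M.+1 s (tab r W 0) ->
  imem s 0 0 = n -> imem s 0 1 = M -> imem s 3 0 = 0%N ->
  rmem s 3 0 = r -> (forall i, rmem s 0 i = W i) ->
  (forall i j, (i <= n)%N -> (size (tab r W i j) <= L)%N) ->
  runs fill_table s (n * (M.+1 * (300 * L + 110) + 50) + 10) (fun s' =>
    same_input s s' /\ table M.+1 s' (tab r W n)).
Proof.
move=> tT s00 s01 s3 r3 r0 sL.
pose Inv k s' := [/\ (imem s' 3 0 + k)%N = n, same_input s s' &
  table M.+1 s' (tab r W (imem s' 3 0))].
apply: runs_le; first apply: (runs_while (Inv := Inv)
    (N := (10 + (M.+1 * (300 * L + 110) + 10 + 20))%N) (k := n)).
- move=> k t [tk [ti tr] tt]; split; first by rewrite /= ti s00; lia.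
  apply: runs_seq; straight; rewrite ti s01 addn1; set t1 := Store _ _.
  apply: runs_weaken (runs_fill_row (r := r) (W := W) (B := M.+1)
    (i := imem t 3 0) (L := L) _ _ _ _ _ _) _ _ => //.
  + by rewrite tr.
  + by rewrite tr.
  + by move=> j; apply: sL; lia.
  move=> t2 [t23 [t2i t2r] tt2]; straight; rewrite t23 addn1.
  split=> /=; first by lia.
  + by split=> [u|a u a4] /=; rewrite ?t2i ?t2r //= ?ti ?tr.
  + exact: tt2.
- move=> t [tk [ti tr] tt]; rewrite addn0 in tk.
  by rewrite /= ti s00 tk leqnn; split=> //; split=> //; rewrite -tk.
- by split=> //; rewrite s3.
- by rewrite /=; lia.
Qed.

Lemma runs_read_off s l : imem s 6 0 = (imem s 5 0 + size l)%N ->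
  holds s (imem s 5 0) l ->
  runs read_off s (size l * 60 + 10)
    (fun s' => rmem s' 2 0 = rmem s 2 0 + cdf l (rmem s 1 0)).
Proof.
move=> sl hl; set tot := _ + _.
pose Inv k s' := exists l', [/\ k = size l', imem s' 6 0 = (imem s' 5 0 + size l')%N,
  holds s' (imem s' 5 0) l', rmem s' 1 0 = rmem s 1 0 &
  rmem s' 2 0 + cdf l' (rmem s 1 0) = tot].
apply: runs_le; first apply: (runs_while (Inv := Inv) (N := 50) (k := size l)).
- move=> k t [[|a l'] [//= kE t6 th t1 tE]]; split; first by rewrite t6; lia.
  have [X1 D1 hl'] := holds_cons th.
  apply: (@runs_le _ _ _ (40 + 10)%N) => //; apply: runs_seq.
  apply: (@runs_le _ _ _ (bcost (BLeR (RLoad 4 (iv 5)) (RLoad 1 (IConst 0))) + 20).+1) => //.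
  rewrite cdf_cons in tE.
  apply: runs_if => /=; rewrite X1 t1 => ac.
    straight; straight; exists l'; split=> //=; first by case: kE.
    + by rewrite t6 addn1 addnS.
    + by rewrite addn1.
    + by rewrite -tE ac D1 addrA.
  straight; straight; exists l'; split=> //=; first by case: kE.
  + by rewrite t6 addn1 addnS.
  + by rewrite addn1.
  + by rewrite -tE (negbTE ac) add0r.
- move=> t [[|a l'] [//= _ t6 _ _ tE]]; split; first by rewrite t6; lia.
  by rewrite -tE /cdf big_nil addr0.
- by exists l.
- by rewrite /=; lia.
Qed.

Lemma runs_knapsack_prog n (w : 'I_n -> nat) M (C eps : R) L :
  let r := 1 - eps / n%:R in
  let W i := oapp (fun j : 'I_n => (w j)%:R) 0 (insub i) in
  (forall i j, (i <= n)%N -> (size (tab r W i j) <= L)%N) ->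
  runs knapsack_prog (knapsack_input w M C eps)
    (n * (M.+1 * (300 * L + 110) + 50) + L * 60 + 100)
    (fun s => output s = cdf (tab r W n M.+1) C).
Proof.
move=> r W sL.
apply: (@runs_le _ _ _ (40 + ((n * (M.+1 * (300 * L + 110) + 50) + 10) +
   (15 + (15 + (L * 60 + 10)))))%N); last by lia.
apply: runs_seq; straight; set s1 := Store _ _.
apply: runs_weaken (runs_fill_table (r := r) (W := W) (n := n) (M := M)
  (L := L) _ _ _ _ _ _ _) _ _ => //.
- move=> j _ /=; case: eqP => _ //=.
  by split=> // -[|[]].
- move=> s2 [[i2 r2] tt]; have [e h H] := tt M.+1 (leqnn _).
  apply: runs_seq; straight; straight.
  rewrite i2 addn1 /=.
  apply: runs_weaken (runs_read_off (l := tab r W n M.+1) _ _) _ _ => //.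
    by rewrite leq_add2r leq_mul2r sL.
  by move=> s3; rewrite /output /= !r2 //= add0r.
Qed.

End Tables.

(** * Sizes of the lists *)

Section TableSize.
Variables (R : realFieldType) (r : R) (W : nat -> R).

Lemma tab_good i j : good (tab r W i j).
Proof.
elim: i j => [|i IHi] [|j] //=; last exact: good_combine.
by case: eqP => //; rewrite /good /= lexx.
Qed.

Lemma tab_mass i j : mass (tab r W i j) <= 2 ^+ i.
Proof.
elim: i j => [|i IHi] [|j] /=; try by rewrite /mass big_nil // exprn_ge0.
  by case: eqP => _; rewrite /mass ?big_cons big_nil ?addr0.
apply: le_trans (mass_combine _ _ (tab_good _ _) (tab_good _ _)) _.
by rewrite exprS mulr_natl mulr2n lerD.
Qed.

End TableSize.

Section Sizes.
Variables (R : realType) (r : R) (W : nat -> R).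
Hypothesis r01 : 0 <= r <= 1.

(** Since [2 <= e] and [r <= exp (r - 1)], the hypothesis gives [1 <= exp (n - (1 - r) k)]. *)
Lemma le_of_expr_ge1 n k : 1 <= 2 ^+ n * r ^+ k -> (1 - r) * k%:R <= n%:R.
Proof.
move=> H; rewrite -subr_ge0 -ler_expR expR0; apply: le_trans H _.
rewrite -mulNr expRD -[n%:R]mulr1 expRM_natl [_ * k%:R]mulrC expRM_natl.
apply: ler_pM; rewrite ?exprn_ge0 ?(andP r01).1 //.
  by apply: lerXn2r; rewrite ?nnegrE ?expR_ge0 //; have := expR_ge1Dx (1 : R).
apply: lerXn2r; rewrite ?nnegrE ?expR_ge0 ?(andP r01).1 //.
by have := expR_ge1Dx (- (1 - r)); lra.
Qed.

Lemma tab_size i j : (1 - r) * (size (tab r W i j))%:R <= i%:R + 1.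
Proof.
have r0 : 0 <= r by case/andP: r01.
have [->|] := posnP (size (tab r W i j)); first by rewrite mulr0; have := ler0n R i; lra.
case: i j => [|i] [|j] //=; first by case: eqP => //= _ _; lra.
move=> sz; have := compress_size r0 _ _ sz; rewrite lexx => /(_ isT).
have /andP[_ am] := good_merge_shift (W i) (tab_good r W i j.+1) (tab_good r W i j).
rewrite add0r => /(_ am) H.
have {H} := le_trans H (ler_wpM2r (exprn_ge0 _ r0) (tab_mass _ _ i.+1 j.+1)).
(* The estimate is for the size minus one; the missing atom costs [1 - r <= 1], which the summand 1
   absorbs. *)
move/le_of_expr_ge1; rewrite -[in X in _ -> X](prednK sz) -natr1; lra.
Qed.

End Sizes.

(** * Correctness of the recursion *)

Section Counting.
Variables (n : nat) (w : 'I_n -> nat) (R : realFieldType).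

(* The number of sets of [j.-1] of the first [i] items of weight at most [c],
   and 0 for [j = 0]. *)
Definition cnt i j (c : R) := #|[set S : {set 'I_n} |
  [&& S \subset [set k : 'I_n | (k < i)%N], #|S|.+1 == j
    & (\sum_(k in S) w k)%N%:R <= c]]|.

Lemma cnt0 j c : cnt 0 j c = (j == 1%N) && (0 <= c).
Proof.
rewrite /cnt; have -> : [set k : 'I_n | (k < 0)%N] = set0 by apply/setP => k; rewrite !inE.
rewrite [j == _]eq_sym; case: (boolP (_ && _)) => H.
  apply: etrans (cards1 (set0 : {set 'I_n})); apply: eq_card => S.
  rewrite !inE subset0; case: eqP => // ->.
  by rewrite cards0 big_set0 H.
apply: eq_card0 => S; rewrite !inE subset0; case: eqP => // ->.
by rewrite cards0 big_set0 (negbTE H).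
Qed.

Lemma cnt_col0 i c : cnt i 0 c = 0%N.
Proof. by apply: eq_card0 => S; rewrite !inE /= andbF. Qed.

(** The sets are split by whether they contain item [i]; adding [i] is a bijection from the sets
    avoiding it onto those containing it. For [j = 0] the second term vanishes, as it should. *)
Lemma cntS (i : 'I_n) j c :
  cnt i.+1 j.+1 c = (cnt i j.+1 c + cnt i j (c - (w i)%:R))%N.
Proof.
have lt_iS : [set k : 'I_n | (k < i.+1)%N] = i |: [set k : 'I_n | (k < i)%N].
  by apply/setP => k; rewrite !inE ltnS leq_eqVlt.
rewrite /cnt lt_iS; set I := [set k : 'I_n | (k < i)%N].
have iI : i \notin I by rewrite inE ltnn.
set A := [set S | _]; rewrite -(cardsID [set S : {set 'I_n} | i \in S] A) addnC.
congr (_ + _)%N.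
  apply: eq_card => S; rewrite !inE; case: (boolP (i \in S)) => iS /=.
    apply/esym/negbTE; apply: contraNN iI => /andP[SI _].
    exact: (subsetP SI).
  by congr (_ && _); rewrite -subDset (setDidPl _) // disjoint_sym disjoints1.
set B := (X in _ = #|pred_of_set X|).
have notB S : S \in B -> i \notin S.
  by rewrite inE => /andP[SI _]; apply: contraNN iI; apply: (subsetP SI).
rewrite -(@card_in_imset _ _ (fun S => i |: S) B) => [|S T /notB iS /notB iT eqST].
  apply: eq_card => S; rewrite !inE.
  apply/andP/imsetP => [[]|[T TB ->]].
    case/and3P=> SI cS wS iS; exists (S :\ i); last by rewrite setD1K.
    rewrite inE subDset SI /=; move: cS wS.
    rewrite (cardsD1 i) iS (big_setD1 i iS) /= natrD => /eqP[<-] wS.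
    by rewrite eqxx /=; lra.
  have iT := notB _ TB; move: TB; rewrite inE => /and3P[TI /eqP cT wT].
  rewrite setU11 setUS // cardsU1 iT -cT eqxx big_setU1 //= natrD; split=> //.
  by lra.
by rewrite -(setU1K iS) -(setU1K iT) eqST.
Qed.

Lemma exact_knapsack_countE M c : exact_knapsack_count w M c = cnt n M.+1 c.
Proof.
apply: eq_card => S; rewrite !inE eqSS andbC.
by have -> : S \subset [set k : 'I_n | (k < n)%N]
  by apply/subsetP => k; rewrite inE ltn_ord.
Qed.

(** Thinning never raises a distribution function, so the upper bound carries no error; the lower
    one loses a factor [r] per item. *)
Lemma tab_cdf r i j c :
  let W k := oapp (fun k : 'I_n => (w k)%:R) (0 : R) (insub k) in
  0 <= r <= 1 -> (i <= n)%N ->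
  r ^+ i * (cnt i j c)%:R <= cdf (tab r W i j) c <= (cnt i j c)%:R.
Proof.
move=> W r01; have r0 : 0 <= r by case/andP: r01.
elim: i j c => [|i IHi] j c lt_in.
  rewrite cnt0 mul1r /=; case: eqP => _ /=.
    by rewrite cdf_cons /cdf big_nil addr0 /=; case: (0 <= c); rewrite lexx.
  by rewrite /cdf big_nil lexx.
case: j => [|j]; first by rewrite cnt_col0 /cdf big_nil mulr0 lexx.
have Wi : W i = (w (Ordinal lt_in))%:R by rewrite /W insubT.
have := combine_cdf (W i) c r01 (tab_good r W i j.+1) (tab_good r W i j).
rewrite (cntS (Ordinal lt_in)) natrD -Wi /= => /andP[lo hi].
have /andP[lo1 hi1] := IHi j.+1 c (ltnW lt_in).
have /andP[lo2 hi2] := IHi j (c - W i) (ltnW lt_in).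
apply/andP; split; last by apply: le_trans hi _; apply: lerD.
by apply: le_trans lo; rewrite exprS -mulrA ler_wpM2l // mulrDr lerD.
Qed.

End Counting.

(** * Conclusion *)

Lemma bernoulli (R : realFieldType) (d : R) n : 0 <= d <= 1 ->
  1 - n%:R * d <= (1 - d) ^+ n.
Proof.
move=> /andP[d0 d1]; elim: n => [|n IHn]; first by rewrite mul0r subr0.
have := mulr_ge0 (mulr_ge0 (ler0n R n) d0) d0.
have := ler_wpM2l (_ : 0 <= 1 - d) IHn; rewrite exprS => /(_ ltac:(lra)).
by rewrite -natr1; nra.
Qed.

(** This is [ln (1 + x) <= x] at [x = -1/2]. *)
Lemma ln2_ge_half (R : realType) : 1 / 2 <= ln (2 : R).
Proof.
have := @le_ln1Dx R (- (1 / 2)).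
have -> : 1 + - (1 / 2) = 2^-1 :> R by lra.
by rewrite lnV ?posrE // => /(_ ltac:(lra)); lra.
Qed.

Lemma time_bound_ge (R : realType) n (eps : R) : 0 < eps ->
  n%:R ^+ 4 / eps <= 2 * time_bound n eps.
Proof.
move=> e0; have x0 : 0 <= n%:R ^+ 4 / eps by rewrite divr_ge0 ?exprn_ge0 // ltW.
have : ln (2 : R) <= ln (Num.max 2 (n%:R / eps)).
  by rewrite ler_ln ?posrE ?lt_max ?le_max ?lexx // ltr0n.
have := ln2_ge_half R; rewrite /time_bound; nra.
Qed.

Theorem theorem1 :
  exists (P : cmd) (K : nat),
    forall (R : realType) (n : nat) (w : 'I_n -> nat) (M : nat) (C eps : R),
      (forall i : 'I_n, (0 < w i)%N) ->
      (1 <= M <= n)%N ->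
      0 < eps < 1 ->
      exists (t : nat) (s : store R),
        [/\ exec P (knapsack_input w M C eps) t s,
            (1 - eps) * (exact_knapsack_count w M C)%:R <= output s
              <= (1 + eps) * (exact_knapsack_count w M C)%:R
          & t%:R <= K%:R * time_bound n eps].
Proof.
(* 4120 is 1030 * 2 * 2: the cost is at most [1030 n^2 L], with [n^2 L <= 2 n^4 / eps] and
   [n^4 / eps] at most twice the time bound. *)
exists knapsack_prog, 4120%N => R n w M C eps _ /andP[M1 Mn] /andP[e0 e1].
have n1 : 1 <= n%:R :> R by rewrite ler1n; lia.
have n0 : 0 < n%:R :> R by lra.
pose d : R := eps / n%:R.
have d0 : 0 < d by apply: divr_gt0.
have nd : n%:R * d = eps by rewrite mulrC divfK // gt_eqF.
have d1 : d <= 1 by nra.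
have r01 : 0 <= 1 - d <= 1 by lra.
pose W i : R := oapp (fun j : 'I_n => (w j)%:R) 0 (insub i).
(* From [d] times the size at most [n + 1 <= 2 n], every list has at most [2 n / d = x] atoms. *)
pose x : R := 2 * n%:R ^+ 2 / eps.
have x2 : 2 <= x by rewrite ler_pdivlMr //; nra.
have x0 : 0 <= x by lra.
pose L := Num.truncn x.
have Lx : L%:R <= x by rewrite truncn_le.
have L1 : (1 <= L)%N by rewrite truncn_ge_nat //; lra.
have sL i j : (i <= n)%N -> (size (tab (1 - d) W i j) <= L)%N.
  move=> lt_in; rewrite truncn_ge_nat // ler_pdivlMr //.
  have := tab_size W r01 i j; have : i%:R <= n%:R :> R by rewrite ler_nat.
  rewrite subKr -nd mulrCA [_ * d]mulrC expr2; nra.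
have [t [s [ex tb out]]] := runs_knapsack_prog M C sL.
exists t, s; split=> //.
- rewrite out exact_knapsack_countE.
  have /andP[lo hi] := tab_cdf w M.+1 C r01 (leqnn n).
  have Z0 := ler0n R (cnt w n M.+1 C).
  have := bernoulli n (_ : 0 <= d <= 1); rewrite nd => /(_ ltac:(lra)) b.
  apply/andP; split; last by apply: le_trans hi _; nra.
  by apply: le_trans lo; apply: ler_wpM2r.
(* With [M + 1 <= 2 n] and [L >= 1], the cost is at most [n^2 L] times 2 * 410 + 50 + 60 + 100 =
   1030. *)
- apply: (@le_trans _ _ (1030 * n ^ 2 * L)%:R).
    by rewrite ler_nat; apply: leq_trans tb _; nia.
  rewrite natrM natrM natrX -mulrA; have := time_bound_ge n e0.
  have : n%:R ^+ 2 * L%:R <= 2 * (n%:R ^+ 4 / eps).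
    have -> : 2 * (n%:R ^+ 4 / eps) = n%:R ^+ 2 * x by rewrite /x; field; lra.
    by rewrite ler_wpM2l // exprn_ge0 // ltW.
  lra.
Qed.
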